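(* For every cubic graph $G$, $\nu_2(G) \geq \frac{4}{5}\cdot |V(G)|$.
   Context: Graphs are finite, without loops, possibly with multiple edges; a graph is cubic if every vertex has degree $3$. For $k\geq 1$, $\nu_k(G)$ is the maximum number of edges of a $k$-edge-colorable subgraph of $G$. *)

(* Defs.v *)
From mathcomp Require Import all_boot.
Set Implicit Arguments. Unset Strict Implicit. Unset Printing Implicit Defensive.

(* A finite multigraph without loops: vertex type V, edge type E, each edge e
   has two endpoints src e, dst e (the orientation is irrelevant). Parallel
   edges are allowed (distinct e with the same endpoints). *)
Record multigraph := Multigraph {
  vert : finType;
  edge : finType;
  src : edge -> vert;
  dst : edge -> vert;
  loopless : forall e, src e != dst e
}.

Definition incident (G : multigraph) (v : vert G) (e : edge G) : bool :=
  (src e == v) || (dst e == v).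

(* degree (no loops, so each incident edge counts once) *)
Definition degree (G : multigraph) (v : vert G) : nat :=
  #|[set e | incident v e]|.

Definition cubic (G : multigraph) : Prop := forall v : vert G, degree v = 3.

Definition adjacent (G : multigraph) (e f : edge G) : bool :=
  (e != f) && [exists v, incident v e && incident v f].

Definition k_colorable_edges (G : multigraph) (k : nat) (F : {set edge G}) : bool :=
  [exists c : {ffun edge G -> 'I_k},
     [forall e in F, forall f in F, adjacent e f ==> (c e != c f)]].

Definition nu (G : multigraph) (k : nat) : nat :=
  \max_(F : {set edge G} | k_colorable_edges k F) #|F|.

(* Main.v *)
Require Import Defs.
From mathcomp Require Import all_boot zify.
Set Implicit Arguments. Unset Strict Implicit. Unset Printing Implicit Defensive.

(* Cover the vertices by disjoint paths and even cycles; if p components are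
   paths (possibly single vertices), alternating colours along the components
   gives a 2-colourable set of |V| - p edges, so it is enough to find a cover
   with 5 p <= |V|. Take a cover minimising 2 (paths) + (even cycles).
   Call a path closed if it spans an odd cycle or is a single vertex (every
   vertex is then an end), and open otherwise. Minimality makes ends of distinct
   components nonadjacent, so the unused edges at ends of open paths and those
   leaving closed paths lead to interior vertices of open paths, each of which
   has exactly one unused edge. Counting these edges charges 6 vertices to an
   open path and |C| + out C to a closed path C, which is enough unless C is a
   single vertex or a triangle with one outgoing edge ("weak"). The missing
   charge comes from a gap argument: between two interior vertices of an open
   path that see weak paths there is an interior vertex that sees no end. *)

(** * Lists of pairwise disjoint lists *)

Lemma flatten_uniq_inj (T : eqType) (ss : seq (seq T)) s1 s2 x :
  uniq (flatten ss) -> s1 \in ss -> s2 \in ss -> x \in s1 -> x \in s2 -> s1 = s2.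
Proof.
elim: ss => //= s ss IH; rewrite cat_uniq => /and3P[_ /hasPn dis uss].
rewrite !inE => /predU1P[->|h1] /predU1P[->|h2] // x1 x2.
- have /dis : x \in flatten ss by apply/flattenP; exists s2.
  by rewrite x1.
- have /dis : x \in flatten ss by apply/flattenP; exists s1.
  by rewrite x2.
- exact: IH.
Qed.

Lemma flatten_uniq_uniq (T : eqType) (ss : seq (seq T)) :
  [::] \notin ss -> uniq (flatten ss) -> uniq ss.
Proof.
elim: ss => //= s ss IH; rewrite inE negb_or cat_uniq => /andP[sn0 ssn0].
case/and3P=> _ /hasPn dis /(IH ssn0) ->; rewrite andbT.
case: s sn0 dis => // x s _ dis; apply/negP => sss.
have /dis : x \in flatten ss by apply/flattenP; exists (x :: s); rewrite ?inE ?eqxx.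
by rewrite inE eqxx.
Qed.

(** * Covers of a cubic multigraph by paths and even cycles *)

Section Core.

(** [m x y] stands for the number of parallel edges between [x] and [y]; the multigraph enters only
    through this adjacency matrix. *)
Variables (V : finType) (m : V -> V -> nat).
Hypothesis mC : forall x y, m x y = m y x.
Hypothesis mxx : forall x, m x x = 0.
Hypothesis m3 : forall x, \sum_y m x y = 3.

Implicit Types (s t : seq V) (cv : seq (seq V)).

Definition adj x y := 0 < m x y.

Lemma adjC x y : adj x y = adj y x.
Proof. by rewrite /adj mC. Qed.

Lemma sorted_rev s : sorted adj (rev s) = sorted adj s.
Proof. by rewrite rev_sorted; apply: eq_sorted => x y; rewrite adjC. Qed.

Lemma sorted_cat_cons x a y b :
  sorted adj (x :: a ++ y :: b) = [&& path adj x a, adj (last x a) y & path adj y b].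
Proof. by rewrite /= cat_path. Qed.

(** Two paths are glued at their first vertices, the first path being traversed backwards. *)
Lemma sorted_join x a y b :
  sorted adj (rev (x :: a) ++ y :: b) = [&& path adj x a, adj x y & path adj y b].
Proof.
rewrite -[path adj x a]/(sorted adj (x :: a)) -[sorted adj (x :: a)]sorted_rev rev_cons.
case: (rev a) => [|z c] //=.
by rewrite cat_path last_rcons.
Qed.

(* The list closes up to an even cycle; for two vertices this needs a second
   parallel edge, the first one being used by the list itself. *)
Definition even_cycle s :=
  if s is x :: t then ~~ odd (size s) && ((size s == 2) < m x (last x t)) else false.

(** A longer list of odd length has at least three vertices, so adjacency of its extremities already
    gives a closing edge outside the list. *)
Definition closed s :=
  if s is x :: t then odd (size s) && ((t == [::]) || adj x (last x t)) else false.

Definition open s := ~~ even_cycle s && ~~ closed s.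

(** Any vertex of a cycle, odd or even, can start a path through all its vertices, hence the
    disjunct [~~ open s]. *)
Definition is_end s r := (r \in s) && [|| ~~ open s, r == head r s | r == last r s].

Lemma not_open_closing x t : ~~ open (x :: t) -> t = [::] \/ adj x (last x t).
Proof.
rewrite negb_and !negbK => /orP[] /=.
  by case/andP=> _ h; right; rewrite /adj; move: h; case: (_ == 2) => //; lia.
by case/andP=> _ /orP[/eqP|]; [left|right].
Qed.

(** A cycle is rotated so as to start at [r]; a path is reversed if [r] is its last vertex. *)
Lemma end_path s r : sorted adj s -> is_end s r ->
  exists2 t, perm_eq (r :: t) s & path adj r t.
Proof.
move=> ps /andP[rs /or3P[ncl|/eqP rh|/eqP rl]].
- case: s rs ncl ps => // x t rs /not_open_closing h ps.
  case/predU1P: rs => [->|]; first by exists t.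
  move/path.splitPr => sp; case: sp h ps => a b h.
  rewrite sorted_cat_cons => /and3P[pa ab pb].
  exists (b ++ x :: a).
    by apply/permP => q; rewrite /= !count_cat /= ; clear; lia.
  case: h => [|h]; first by case: (a).
  by rewrite cat_path pb /= pa adjC andbT; rewrite last_cat /= in h.
- by case: s rs rh ps => // x t _ /= -> ps; exists t.
- case/lastP: s rs rl ps => // t x _; rewrite last_rcons => <- ps.
  exists (rev t); first by rewrite -rev_rcons perm_rev.
  by rewrite -[path _ _ _]/(sorted adj (r :: rev t)) -rev_rcons sorted_rev.
Qed.

Definition weight s := if even_cycle s then 1 else 2.

Definition cover cv := perm_eq (flatten cv) (enum V) && all (sorted adj) cv.

Definition out s := \sum_(r <- s) \sum_(y | y \notin s) m r y.

(** These are the closed paths whose basic charge [size s + out s], with [out s] the number of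
    leaving edges, falls short of five vertices. *)
Definition weak s := closed s && (size s + out s < 5).

Lemma closed_odd s : closed s -> odd (size s).
Proof. by case: s => // x s /andP[]. Qed.

Lemma closed_not_even s : closed s -> ~~ even_cycle s.
Proof. by move/closed_odd; case: s => //= x s ->. Qed.

Lemma closed_not_open s : closed s -> ~~ open s.
Proof. by rewrite negb_and orbC negbK => ->. Qed.

Lemma closed_end s r : closed s -> r \in s -> is_end s r.
Proof. by move=> /closed_not_open h rs; rewrite /is_end rs h. Qed.

(** Two distinct outside neighbours give two leaving edges, so [s] has fewer than three vertices,
    and its length is odd. *)
Lemma weak_out s r r' x x' : uniq s -> weak s -> r \in s -> r' \in s ->
  x \notin s -> x' \notin s -> adj r x -> adj r' x' -> x != x' -> s = [:: r].
Proof.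
move=> us /andP[/closed_odd os ws] rs rs' xs xs' rx rx' xx'.
have : 1 < out s.
  rewrite /out exchange_big /= (bigD1 x) //= (bigD1 x') //=; last by rewrite xs' eq_sym.
  rewrite (bigD1_seq r) //= [in X in _ + (X + _)](bigD1_seq r') //=.
  by move: rx rx'; rewrite /adj; clear; lia.
by case: s os ws rs {us rs' xs xs'} => [|a [|b [|c s]]] //=; rewrite ?inE => *; [f_equal;
  apply/esym/eqP|lia].
Qed.

(** * Exchange arguments in a cover of minimum weight *)

Section Minimal.

Variable cv : seq (seq V).
Hypothesis cvP : cover cv.
Hypothesis cv_min : forall cv', cover cv' ->
  sumn (map weight cv) <= sumn (map weight cv').

Lemma cv_uniq_flatten : uniq (flatten cv).
Proof. by case/andP: cvP => /perm_uniq -> _; rewrite enum_uniq. Qed.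

Lemma part_sorted s : s \in cv -> sorted adj s.
Proof. by case/andP: cvP => _ /allP; apply. Qed.

(** The empty list has weight 2, so dropping it would give a cheaper cover. *)
Lemma cv_nil : [::] \notin cv.
Proof.
apply/negP => /perm_to_rem pe.
have := cv_min (cv' := rem [::] cv).
rewrite (perm_sumn (perm_map weight pe)) /= add2n => h.
suff /h : cover (rem [::] cv) by lia.
case/andP: cvP => pf ps; rewrite /cover -(permPr pf) perm_sym.
rewrite (permPl (perm_flatten pe)) perm_refl /=.
by move: ps; rewrite (perm_all _ pe).
Qed.

Lemma cv_uniq : uniq cv.
Proof. exact: flatten_uniq_uniq cv_nil cv_uniq_flatten. Qed.

Lemma part_eq s t x : s \in cv -> t \in cv -> x \in s -> x \in t -> s = t.
Proof. exact: flatten_uniq_inj cv_uniq_flatten. Qed.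

Lemma part_of x : exists2 s, s \in cv & x \in s.
Proof.
apply/flattenP; case/andP: cvP => /perm_mem -> _; exact: mem_enum.
Qed.

Lemma part_uniq s : s \in cv -> uniq s.
Proof.
move=> /perm_to_rem /perm_flatten /perm_uniq; rewrite cv_uniq_flatten.
by move/esym; rewrite cat_uniq => /andP[].
Qed.

(** Local form of minimality: [new] and the lists outside [old] again form a cover. *)
Lemma exchange old new : uniq old -> {subset old <= cv} ->
  perm_eq (flatten new) (flatten old) -> all (sorted adj) new ->
  sumn (map weight old) <= sumn (map weight new).
Proof.
move=> uo so pno sn; pose rest := [seq s <- cv | s \notin old].
have pe : perm_eq cv (old ++ rest).
  rewrite -(perm_filterC (mem old) cv) perm_cat2r.
  apply: uniq_perm => //; first exact: filter_uniq cv_uniq.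
  by move=> s; rewrite mem_filter andb_idr //; exact: so.
have := cv_min (cv' := new ++ rest).
rewrite (perm_sumn (perm_map weight pe)) !map_cat !sumn_cat leq_add2r; apply.
case/andP: cvP => pf ps; rewrite /cover -(permPr pf) all_cat sn /=.
move: ps; rewrite (perm_all _ pe) all_cat => /andP[_ ->].
by rewrite andbT (permPr (perm_flatten pe)) !flatten_cat perm_cat2r.
Qed.

Lemma weight_odd s : ~~ even_cycle s -> weight s = 2.
Proof. by rewrite /weight => /negPf->. Qed.

Lemma weight_bounds s : 0 < weight s <= 2.
Proof. by rewrite /weight; case: ifP. Qed.

(** The two lists weigh at least 2 + 1, a single path [t] at most 2. *)
Lemma no_merge s1 s2 t : s1 \in cv -> s2 \in cv -> s1 != s2 ->
  ~~ even_cycle s1 -> perm_eq t (s1 ++ s2) -> ~~ sorted adj t.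
Proof.
move=> c1 c2 ne e1 pt; apply/negP => st.
suff : weight s1 + (weight s2 + 0) <= weight t + 0.
  by rewrite weight_odd //; move: (weight_bounds t) (weight_bounds s2); clear; lia.
apply: (@exchange [:: s1; s2] [:: t]) => /=.
- by rewrite inE ne.
- by move=> z; rewrite !inE => /orP[] /eqP->.
- by rewrite !cats0.
- by rewrite st.
Qed.

(** Three paths weigh 6, the two new lists at most 4. *)
Lemma no_merge3 s1 s2 s3 t1 t2 : s1 \in cv -> s2 \in cv -> s3 \in cv ->
  uniq [:: s1; s2; s3] -> ~~ even_cycle s1 -> ~~ even_cycle s2 -> ~~ even_cycle s3 ->
  perm_eq (t1 ++ t2) (s1 ++ s2 ++ s3) -> ~~ (sorted adj t1 && sorted adj t2).
Proof.
move=> c1 c2 c3 u e1 e2 e3 pt; apply/negP => st.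
suff : weight s1 + (weight s2 + (weight s3 + 0)) <= weight t1 + (weight t2 + 0).
  by rewrite (weight_odd e1) (weight_odd e2) (weight_odd e3);
    move: (weight_bounds t1) (weight_bounds t2); clear; lia.
apply: (@exchange [:: s1; s2; s3] [:: t1; t2]) => //=.
- by move=> z; rewrite !inE => /or3P[] /eqP->.
- by rewrite !cats0.
- by rewrite andbT.
Qed.

(** Reading both components from these ends, an edge would join them into one path. *)
Lemma ends_nonadjacent s s' r r' : s \in cv -> s' \in cv -> s != s' ->
  ~~ even_cycle s -> is_end s r -> is_end s' r' -> ~~ adj r r'.
Proof.
move=> cs cs' ss' es ers ers'; apply/negP => rr'.
have [t pt ht] := end_path (part_sorted cs) ers.
have [t' pt' ht'] := end_path (part_sorted cs') ers'.
have /(no_merge cs cs' ss' es)/negP : perm_eq (rev (r :: t) ++ r' :: t') (s ++ s').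
  by apply: perm_cat; rewrite ?perm_rev.
by case; rewrite sorted_join ht rr' ht'.
Qed.

Lemma end_neighbour s r y : s \in cv -> ~~ even_cycle s -> is_end s r ->
  y \notin s -> adj r y ->
  exists s', [/\ s' \in cv, open s', y \in s', y != head y s' & y != last y s'].
Proof.
move=> cs es rs ys ry; have [s' cs' ys'] := part_of y; exists s'.
have ss' : s != s' by apply: contraNneq ys => ->.
have : ~~ is_end s' y by apply: contraL ry; apply: (ends_nonadjacent cs cs' ss' es rs).
by rewrite /is_end ys' /= !negb_or negbK => /and3P[]; split.
Qed.

(* Cutting [s] after [x] and hanging its initial part on the weak component
   leaves a path with end [b], so [b] sees no end of another component. *)
Lemma after_weak_neighbour s s' A x b E T rx C r :
  s \in cv -> open s -> perm_eq s' s -> s' = A ++ x :: b :: E -> sorted adj s' ->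
  (forall z, is_end s z -> z = head z s' \/ z = last z s') ->
  T \in cv -> weak T -> rx \in T -> adj rx x ->
  C \in cv -> ~~ even_cycle C -> is_end C r -> adj r b ->
  C = s /\ r = last b E.
Proof.
move=> cs os ps ds; rewrite ds => so ends cT wT rT rx_x cC eC rC rb.
have clT : closed T by case/andP: wT.
have es : ~~ even_cycle s by case/andP: os.
have Ts : T != s by apply: contraTneq os => <-; apply: closed_not_open.
have us : uniq s := part_uniq cs.
have [xs bs] : x \in s /\ b \in s.
  by rewrite -!(perm_mem ps) ds !mem_cat !inE !eqxx !orbT.
have inT z : z \in s -> z \notin T.
  by move=> zs; apply: contraNN Ts => zT; apply/eqP/(part_eq cT cs zT zs).
have xb : x != b.
  by move: us; rewrite -(perm_uniq ps) ds cat_uniq => /and3P[_ _];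
    rewrite /= inE negb_or -andbA => /andP[].
have [t pt ht] := end_path (part_sorted cT) (closed_end clT rT).
have {}so : [/\ path adj x (rev A), adj x b & path adj b E].
  move: so; rewrite -cat_rcons -[rcons A x]revK rev_rcons sorted_join.
  by case/and3P.
case: so => pA xb' pE.
have [Cs|Cs] := eqVneq C s; last first.
  have [CT|CT] := eqVneq C T.
    (* [T] sees the distinct vertices [x] and [b], so it is a single vertex, which could be inserted
       between them. *)
    have T1 : T = [:: rx].
      apply: (weak_out (part_uniq cT) wT rT _ (inT _ xs) (inT _ bs) rx_x rb xb).
      by rewrite -CT; case/andP: rC.
    have rrx : r = rx.
      by case/andP: rC; rewrite CT T1 inE => /eqP.
    have /(no_merge cs cT _ es)/negP[] :
        perm_eq (rev (x :: rev A) ++ rx :: b :: E) (s ++ T).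
    - rewrite rev_cons revK T1 -(permPr (perm_cat ps (perm_refl _))) ds.
      by apply/permP => q; rewrite cat_rcons !count_cat /=; clear; lia.
    - by rewrite eq_sym.
    - by rewrite sorted_join pA adjC rx_x /= -rrx rb pE.
  have [c pc hc] := end_path (part_sorted cC) rC.
  (* Three components would become two: [T] continued from [x] back to the start of [s], and [C]
     continued from [b] to its end. *)
  have /(no_merge3 cs cT cC)/negP[] :
     perm_eq ((rev (rx :: t) ++ x :: rev A) ++ (rev (r :: c) ++ b :: E)) (s ++ T ++ C).
  - apply/permP => q; rewrite !count_cat !count_rev -(permP ps) -(permP pt) -(permP pc) ds.
    by rewrite count_cat /= count_rev; clear; lia.
  - by rewrite /= !inE negb_or ![_ == C]eq_sym Cs CT eq_sym Ts.
  - by [].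
  - exact: closed_not_even.
  - by [].
  - by rewrite !sorted_join ht rx_x pA hc rb pE.
split=> //.
have [rh|] := ends r (eq_ind _ (fun z => is_end z r) rC _ Cs); last by rewrite last_cat.
(* If [r] were the first vertex, one path would run through [T], from [x] back to [r], over the edge
   to [b], and on to the last vertex. *)
have /(no_merge cs cT _ es)/negP[] :
    perm_eq (rev (rx :: t) ++ x :: rev A ++ b :: E) (s ++ T).
- apply/permP => q; rewrite !count_cat !count_rev -(permP ps) -(permP pt) ds.
  by rewrite /= !count_cat count_rev /=; clear; lia.
- by rewrite eq_sym.
rewrite sorted_join ht rx_x cat_path pA /= pE andbT.
move: rb; case: A rh {ds ends pA} => [|a A] /= ->; first by rewrite xb'.
by rewrite rev_cons last_rcons.
Qed.

(** * Interior vertices that see ends, and the gap property *)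

Definition interior y := has (fun s => [&& open s, y \in s, y != head y s & y != last y s]) cv.

(** The end may lie in the component of [y] itself, and the edge may be one of that path. *)
Definition reached y :=
  has (fun s => ~~ even_cycle s && has (fun r => is_end s r && adj r y) s) cv.

Definition weakly_reached y := has (fun s => weak s && has (adj^~ y) s) cv.

Lemma interiorE s y : s \in cv -> y \in s ->
  interior y = [&& open s, y != head y s & y != last y s].
Proof.
move=> cs ys; apply/hasP/idP => [[s' cs' /and4P[os' ys' h l]]|/and3P[os h l]].
  by rewrite (part_eq cs cs' ys ys') os' h l.
by exists s; rewrite ?os ?ys ?h ?l.
Qed.

(** A single vertex is closed and the empty list does not occur, so an open path has two
    extremities. *)
Lemma open_shape s : s \in cv -> open s -> exists a M d, s = a :: rcons M d.
Proof.
case: s => [|a s]; first by rewrite (negPf cv_nil).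
case/lastP: s => [|M d] _; first by rewrite /open /= ?eqxx ?andbF.
by exists a, M, d.
Qed.

Lemma interior_shape a M d y : a :: rcons M d \in cv -> open (a :: rcons M d) ->
  y \in a :: rcons M d -> interior y = (y \in M).
Proof.
move=> cs os ys; rewrite (interiorE cs ys) os /= last_rcons.
have := part_uniq cs; rewrite /= rcons_uniq mem_rcons inE negb_or.
case/and3P=> /andP[ad aM] dM _; move: ys; rewrite inE mem_rcons inE.
case/or3P=> [/eqP->|/eqP->|yM].
- by rewrite eqxx (negPf aM).
- by rewrite eqxx (negPf dM) andbF.
- by rewrite yM !(contraTneq _ yM) // => ->.
Qed.

Lemma open_end s z : open s -> is_end s z -> z = head z s \/ z = last z s.
Proof. by move=> os; rewrite /is_end os /= => /andP[_ /orP[]/eqP ?]; [left|right]. Qed.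

(** If every vertex of [B] saw an end, the vertices following [x] and preceding [y] would see
    opposite extremities of [s], and these edges let [s] absorb a weak path. *)
Lemma gap s A x B y D : s \in cv -> open s -> s = A ++ x :: B ++ y :: D ->
  interior x -> weakly_reached x -> interior y -> weakly_reached y ->
  has (fun z => interior z && ~~ reached z) B.
Proof.
move=> cs os ds ix /hasP[T cT /andP[wT /hasP[rx rT rx_x]]].
move=> iy /hasP[T' cT' /andP[wT' /hasP[ry rT' ry_y]]].
apply/negPn/negP => /hasPn hB.
have so := part_sorted cs; have us := part_uniq cs.
have clT : closed T by case/andP: wT.
have clT' : closed T' by case/andP: wT'.
have Ts : T != s by apply: contraTneq os => <-; apply: closed_not_open.
have Ts' : T' != s by apply: contraTneq os => <-; apply: closed_not_open.
have es : ~~ even_cycle s by case/andP: os.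
have xs : x \in s by rewrite ds !mem_cat !inE eqxx !orbT.
have ys : y \in s by rewrite ds !(mem_cat, inE) eqxx !orbT.
have hit z : z \in B -> interior z -> exists C r,
    [/\ C \in cv, ~~ even_cycle C, is_end C r & adj r z].
  move=> zB iz; have := hB z zB; rewrite iz negbK => /hasP[C cC /andP[eC]].
  by case/hasP=> r _ /andP[eCr rz]; exists C, r.
have [a [M [d dM]]] := open_shape cs os.
have [A1 dA] : exists A1, A = a :: A1.
  move: ix; rewrite (interiorE cs xs) ds => /and3P[_ + _].
  case: A ds => [|a' A1] /= ds; first by rewrite eqxx.
  by exists A1; move: dM; rewrite ds => -[<-].
have [D1 dD] : exists D1, D = rcons D1 d.
  move: iy; rewrite (interiorE cs ys) ds => /and3P[_ _].
  case/lastP: D ds => [|D1 d'] ds; first by rewrite !(last_cat, last_cons) eqxx.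
  exists D1; move: (congr1 (last d) dM).
  by rewrite ds !(last_cat, last_cons, last_rcons) => ->.
have mM : M = A1 ++ x :: B ++ y :: D1.
  move: dM; rewrite ds dA dD /= -rcons_cons -rcons_cat -rcons_cons -rcons_cat => -[].
  by move/rcons_inj => [].
have inner z : z \in B -> interior z.
  move=> zB; have zM : z \in M by rewrite mM !(mem_cat, inE) zB !orbT.
  by rewrite (@interior_shape a M d) -?dM // dM inE mem_rcons inE zM !orbT.
have [t pt ht] := end_path (part_sorted cT) (closed_end clT rT).
have hd z : is_end s z -> z = head z s \/ z = last z s by exact: open_end.
(* The first vertex of [B] sees some end, which can only be the last vertex [d] of [s]. *)
have fwd b B1 : B = b :: B1 -> adj d b.
  move=> dB; have bB : b \in B by rewrite dB inE eqxx.
  have [C [r [cC eC rC rb]]] := hit b bB (inner b bB).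
  have ds' : s = A ++ x :: b :: (B1 ++ y :: D) by rewrite ds dB.
  have [_ dr] := after_weak_neighbour cs os (perm_refl s) ds' so hd cT wT rT rx_x cC eC rC rb.
  by move: rb; rewrite dr last_cat dD /= last_rcons.
(* Mirror image: [s] is read backwards, with [T'] and [y] in place of [T] and [x]. *)
have bwd b B1 : B = rcons B1 b -> adj a b.
  move=> dB; have bB : b \in B by rewrite dB mem_rcons inE eqxx.
  have [C [r [cC eC rC rb]]] := hit b bB (inner b bB).
  have ds' : rev s = rev D ++ y :: b :: (rev B1 ++ x :: rev A).
    by rewrite ds dB !(rev_cat, rev_cons, rev_rcons) -!cats1 -!catA.
  have ps : perm_eq (rev s) s by rewrite perm_rev.
  have hd' z : is_end s z -> z = head z (rev s) \/ z = last z (rev s).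
    by rewrite dM rev_cons rev_rcons /= last_rcons => /(open_end _)[];
      rewrite -?dM // dM /= ?last_rcons; [right|left].
  have so' : sorted adj (rev s) by rewrite sorted_rev.
  have [_ dr] := after_weak_neighbour cs os ps ds' so' hd' cT' wT' rT' ry_y cC eC rC rb.
  by move: rb; rewrite dr last_cat dA rev_cons /= last_rcons.
(* If [B] is empty, [y] itself follows [x], yet it sees an end of [T'], which is not [s]. *)
case: (lastP B) fwd bwd ds {hB hit inner mM} => [|B2 b'] fwd bwd ds.
  have [] := after_weak_neighbour cs os (perm_refl s) ds so hd cT wT rT rx_x cT'
    (closed_not_even clT') (closed_end clT' rT') ry_y.
  by move/eqP; rewrite (negPf Ts').
have {}bwd := bwd b' B2 erefl.
have {}fwd : adj d (last b' (rev B2)).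
  by case: B2 fwd {ds bwd} => [|b B2] fwd; rewrite ?rev_cons ?last_rcons; exact: fwd.
(* The last vertex [d] of [s] sees the first vertex of [B] and the first vertex
   [a] of [s] sees the last one, so [T] and [s] merge into one path. *)
have /(no_merge cs cT _ es)/negP[] :
  perm_eq (rev (rx :: t) ++ x :: rev A ++ (b' :: rev B2) ++ rev (y :: D)) (s ++ T).
- apply/permP => q; rewrite !count_cat !count_rev -(permP pt) ds.
  by rewrite -cats1 /= !(count_cat, count_rev) /= !(count_cat, count_rev) /=; clear; lia.
- by rewrite eq_sym.
have ps : d :: rev D1 ++ y :: (b' :: rev B2) ++ x :: rev A = rev s.
  by rewrite ds dD !(rev_cat, rev_cons, rev_rcons) -!cats1 -!catA.
move: so; rewrite -sorted_rev -ps sorted_cat_cons /= cat_path /=.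
case/and5P=> pD Dy _ pB /andP[_ pA].
rewrite sorted_join ht rx_x cat_path pA /= cat_path pB.
rewrite rev_cons dD rev_rcons /= rcons_path pD Dy andbT.
by rewrite dA rev_cons last_rcons bwd adjC fwd.
Qed.

(** * Edges left over by the open paths *)

Definition consec s x y := [&& x \in s, y \in s &
  (index x s == (index y s).+1) || ((index x s).+1 == index y s)].

(* Since the lists have no repetition, at most one of the edges joining [x] and [y]
   is used by an open path. *)
Definition used x y := has (fun s => open s && consec s x y) cv.

(** Only edges of open paths are subtracted; those along closed paths and even cycles stay
    residual. *)
Definition residual x y := m x y - used x y.

Lemma consecC s x y : consec s x y = consec s y x.
Proof. by rewrite /consec andbCA orbC eq_sym [_.+1 == _]eq_sym. Qed.

Lemma usedC x y : used x y = used y x.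
Proof. by apply: eq_has => s; rewrite consecC. Qed.

Lemma residualC x y : residual x y = residual y x.
Proof. by rewrite /residual mC usedC. Qed.

Lemma usedE s x y : s \in cv -> y \in s -> used x y = open s && consec s x y.
Proof.
move=> cs ys; apply/hasP/idP => [[s' cs' /andP[os' c]]|]; last by exists s.
by case/and3P: (c) => _ ys' _; rewrite -(part_eq cs' cs ys' ys) os'.
Qed.

Lemma consec_adj s x y : sorted adj s -> consec s x y -> adj x y.
Proof.
move=> /(sortedP x) so /and3P[xs ys /orP[/eqP e|/eqP e]].
- by have := so (index y s); rewrite -e index_mem xs !nth_index // adjC => ->.
- by have := so (index x s); rewrite e index_mem ys !nth_index // => ->.
Qed.

Lemma used_le x y : used x y <= m x y.
Proof.
case: (boolP (used x y)) => // /hasP[s cs /andP[_ c]].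
exact: consec_adj (part_sorted cs) c.
Qed.

(** The summands stand for the positions after and before [k]; the latter, [k - 1], lies below [n]
    exactly when [k <= n]. *)
Lemma sum_consec_index n k :
  \sum_(0 <= i < n) ((i == k.+1) || (i.+1 == k)) = (k.+1 < n) + (0 < k <= n).
Proof.
elim: n => [|n IH]; first by rewrite big_nil; clear; case: k.
by rewrite big_nat_recr //= IH; clear; lia.
Qed.

(** The first term records a predecessor of [y] on the path, the second a successor. *)
Lemma sum_used s y : s \in cv -> open s -> y \in s ->
  \sum_x used x y = (y != head y s) + (y != last y s).
Proof.
move=> cs os ys; have us := part_uniq cs.
rewrite (bigID (mem s)) /= [X in _ + X]big1 => [|x xs]; last first.
  by rewrite (usedE _ cs ys) /consec (negPf xs) andbF.
rewrite -big_uniq // addn0 (big_nth y).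
rewrite (eq_big_nat _ _ (F2 := fun i => (i == (index y s).+1) || (i.+1 == index y s) : nat)).
  rewrite sum_consec_index; have ks := ys; rewrite -index_mem in ks.
  have -> : (y != head y s) = (0 < index y s).
    case: s ys {cs os us ks} => // a s _ /=.
    by rewrite [y == a]eq_sym; case: (a == y).
  have -> : (y != last y s) = ((index y s).+1 != size s).
    congr (~~ _); apply/eqP/eqP => [e|e]; last first.
      by rewrite -nth_last -e /= nth_index.
    case: s ys us e {cs os ks} => // a s _ us /= e.
    by have := index_last us; rewrite /= -e => ->.
  have aux k n : k < n -> (k.+1 < n) + (0 < k <= n) = (0 < k) + (k.+1 != n).
    by clear; lia.
  exact: aux ks.
move=> i /andP[_ ilt]; rewrite (usedE _ cs ys) os /consec ys mem_nth //= index_uniq //.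
Qed.

(** The path uses two of the three edges at [y]. *)
Lemma residual_interior y : interior y -> \sum_r residual r y = 1.
Proof.
move=> /hasP[s cs /and4P[os ys yh yl]].
have e : \sum_r residual r y + \sum_r used r y = 3.
  rewrite -(m3 y) -big_split /=; apply: eq_bigr => r _.
  by rewrite mC subnK // used_le.
by move: e; rewrite (sum_used cs os ys) yh yl; clear; lia.
Qed.

Lemma end_interior s r y : s \in cv -> ~~ even_cycle s -> is_end s r ->
  y \notin s -> adj r y -> interior y.
Proof.
move=> cs es rs ys ry; have [s' [cs' os' ys' h l]] := end_neighbour cs es rs ys ry.
by rewrite (interiorE cs' ys') os' h l.
Qed.

(** The path uses one of the three edges at [r]. The other two miss the opposite extremity, and
    every neighbour of [r] outside [s] is interior. *)
Lemma residual_open_end s r : s \in cv -> open s -> is_end s r ->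
  \sum_(y | interior y) residual r y = 2.
Proof.
move=> cs os rs; have es : ~~ even_cycle s by case/andP: os.
have us := part_uniq cs.
have [rs' hl] := (proj1 (andP rs), open_end os rs).
have [a [M [d ds]]] := open_shape cs os.
have ad : a != d.
  by apply: contraTneq us => e; rewrite ds e /= mem_rcons inE eqxx.
(* On two vertices a second parallel edge would make an even cycle; on more vertices any edge
   between the extremities would close the list. *)
have residual_ad : residual a d = 0.
  apply/eqP; rewrite /residual subn_eq0 (usedE (s := s)) // ?ds;
    last by rewrite inE mem_rcons inE eqxx orbT.
  move: os; rewrite ds /open /= last_rcons size_rcons /=.
  case: M {ds} => [|b M] /= os.
    rewrite /open /= /consec !inE !eqxx ?orbT /= !eqxx (negPf ad) /=.
    by move: os; clear; lia.
  by move: os; rewrite /adj; clear; case: odd => /=; lia.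
have residual0 y : ~~ interior y -> residual r y = 0.
  move=> iy; have [ys|ys] := boolP (y \in s); last first.
    have : ~~ adj r y by exact: contra (end_interior cs es rs ys) iy.
    by rewrite /adj /residual; clear; lia.
  have {}iy : (y == a) || (y == d).
    move: iy; rewrite (interiorE cs ys) os ds /= last_rcons.
    by case: eqP => //=; case: eqP.
  have {}hl : (r == a) || (r == d).
    by move: hl; rewrite ds /= last_rcons => -[] ->; rewrite eqxx ?orbT.
  by case/orP: iy => /eqP->; case/orP: hl => /eqP->;
    rewrite ?[residual d a]residualC ?residual_ad // /residual mxx.
have e : \sum_y residual r y + \sum_y used y r = 3.
  rewrite -(m3 r) -big_split /=; apply: eq_bigr => y _.
  by rewrite usedC subnK // used_le.
move: e; rewrite (sum_used cs os rs') (bigID interior) /= [X in _ + X + _]big1 //.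
have da : d != a by rewrite eq_sym.
by case: hl => ->; rewrite ds /= last_rcons eqxx ?ad ?da /=; clear; lia.
Qed.

(** No vertex of [s] is interior, while all neighbours outside [s] are. *)
Lemma residual_closed s r : s \in cv -> closed s -> r \in s ->
  \sum_(y | interior y) residual r y = \sum_(y | y \notin s) m r y.
Proof.
move=> cs cl rs; rewrite big_mkcond [RHS]big_mkcond /=; apply: eq_bigr => y _.
have nos := closed_not_open cl.
have [ys|ys] := boolP (y \in s); first by rewrite (interiorE cs ys) (negPf nos).
case: ifP => iy; first by rewrite /residual usedC (usedE _ cs rs) (negPf nos) subn0.
have : ~~ adj r y.
  apply: contraFN iy; apply: (end_interior cs (closed_not_even cl)) => //.
  exact: closed_end.
by rewrite /adj -eqn0Ngt => /eqP->.
Qed.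

Lemma sum_inside s : uniq s ->
  out s + \sum_(r <- s) \sum_(y <- s) m r y = 3 * size s.
Proof.
move=> us; rewrite -big_split /= -sum1_size big_distrr /=; apply: eq_bigr => r _.
by rewrite big_uniq //= muln1 -(m3 r) [RHS](bigID (mem s)) addnC.
Qed.

(** A single vertex has three leaving edges. A triangle has an odd number of them by the degree sum;
    if there is only one, weakness counts it twice and the total is exactly 5. *)
Lemma closed_weight s : s \in cv -> closed s -> 5 <= weak s * out s + out s + size s.
Proof.
move=> cs cl; have us := part_uniq cs; have := sum_inside us.
rewrite /weak cl /=; have := closed_odd cl.
case: s {cs cl us} => [|a [|b [|c [|d [|e s]]]]] //= _.
- by rewrite !(big_cons, big_nil) !mxx; clear; lia.
- by rewrite !(big_cons, big_nil) !mxx [m b a]mC [m c a]mC [m c b]mC; case: ltnP; clear; lia.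
- by clear; lia.
Qed.

(** * Double counting of residual edges and the bound on the number of paths *)

Lemma sum_parts (P : pred V) (F : V -> nat) :
  \sum_(y | P y) F y = \sum_(s <- cv) \sum_(y <- s | P y) F y.
Proof.
rewrite -big_flatten; transitivity (\sum_(y <- enum V | P y) F y).
  by rewrite big_enum_cond.
by apply/esym/perm_big; case/andP: cvP.
Qed.

(** An interior vertex has a single residual edge, so it is hit at most once. *)
Lemma hits_le (P Q : pred V) : (forall r y, P r -> adj r y -> Q y) ->
  \sum_(r | P r) \sum_(y | interior y) residual r y <= \sum_(y | interior y) Q y.
Proof.
move=> PQ; rewrite exchange_big /=; apply: leq_sum => y iy.
case: (boolP (Q y)) => [_|nQ].
  by rewrite -[leqRHS]/1 -(residual_interior iy) [leqRHS](bigID P) /= leq_addr.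
rewrite big1 // => r Pr; have : ~~ adj r y by apply: contra nQ; apply: PQ.
by rewrite /adj /residual; clear; lia.
Qed.

Lemma count_gap (P Q : pred V) s :
  (forall A x B y D, s = A ++ x :: B ++ y :: D -> P x -> P y -> has Q B) ->
  count P s <= (count Q s).+1.
Proof.
elim: {s}_.+1 {-2}s (ltnSn (size s)) => // n IH [|z s] //=; rewrite ltnS => ns hs.
have hs' : forall A x B y D, s = A ++ x :: B ++ y :: D -> P x -> P y -> has Q B.
  by move=> A x B y D ds; apply: (hs (z :: A) x B y D); rewrite ds.
case: (boolP (P z)) => Pz /=; last first.
  by apply: leq_trans (IH s ns hs') _; rewrite ltnS leq_addl.
case: (boolP (has P s)) => [|nP]; last first.
  by move: nP; rewrite has_count; clear; lia.
move=> hP; case/split_find: hP hs hs' ns => y B D Py nB hs hs' ns.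
rewrite cat_rcons count_cat /= Py.
have QB : has Q B by apply: (hs [::] z B y D); rewrite ?cat_rcons.
(* The induction restarts at [y] itself, since [y] also opens the next gap. *)
have /(_ _ _)/= IHD := IH (y :: D).
have {IHD} : count P (y :: D) <= (count Q (y :: D)).+1.
  apply: IHD; first by move: ns; rewrite size_cat size_rcons; clear; lia.
  by move=> A x B' y' D' ds; apply: (hs' (B ++ A) x B' y' D'); rewrite -catA -ds cat_rcons.
move: QB nB; rewrite !has_count count_cat /= Py; clear; lia.
Qed.

Lemma interior_count s : s \in cv ->
  count interior s + 2 * open s = open s * size s.
Proof.
move=> cs; case: (boolP (open s)) => os; last first.
  by apply/eqP; rewrite addn0 mul0n -leqn0 leqNgt -has_count; apply/hasPn => y ys;
    rewrite (interiorE cs ys) (negPf os).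
have [a [M [d ds]]] := open_shape cs os.
rewrite mul1n muln1 ds /= size_rcons -cats1 count_cat /=.
have [cs' os'] : a :: rcons M d \in cv /\ open (a :: rcons M d) by rewrite -ds.
have us := part_uniq cs; rewrite ds /= rcons_uniq mem_rcons inE negb_or in us.
rewrite !(@interior_shape a M d) ?inE ?mem_rcons ?inE ?eqxx ?orbT //.
have -> : count interior M = size M.
  apply/eqP; rewrite -all_count; apply/allP => y yM.
  by rewrite (@interior_shape a M d) // inE mem_rcons inE yM !orbT.
by case/and3P: us => /andP[_ /negPf->] /negPf-> _; clear; lia.
Qed.

(** Hits on interior vertices are bounded below through the edges that ends emit and above, along
    each open path, by the gap property; they cancel in the sum over all components. *)
Lemma few_paths : 5 * count (predC even_cycle) cv <= #|V|.
Proof.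
pose isR r := has (fun s => ~~ even_cycle s && is_end s r) cv.
pose isW r := has (fun s => weak s && (r \in s)) cv.
have isRE s r : s \in cv -> r \in s -> isR r = ~~ even_cycle s && is_end s r.
  move=> cs rs; apply/hasP/idP => [[s' cs' /andP[e' r']]|]; last by exists s.
  by rewrite (part_eq cs cs' rs (proj1 (andP r'))) e'.
have isWE s r : s \in cv -> r \in s -> isW r = weak s.
  move=> cs rs; apply/hasP/idP => [[s' cs' /andP[e' r']]|w]; last by exists s; rewrite ?w.
  by rewrite (part_eq cs cs' rs r').
have hitR : \sum_(r | isR r) \sum_(y | interior y) residual r y <= \sum_(y | interior y) reached y.
  apply: hits_le => r y /hasP[s cs /andP[e rs]] ry; apply/hasP; exists s => //.
  by rewrite e; apply/hasP; exists r; rewrite ?rs //; case/andP: rs.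
have hitW : \sum_(r | isW r) \sum_(y | interior y) residual r y <=
  \sum_(y | interior y) weakly_reached y.
  apply: hits_le => r y /hasP[s cs /andP[e rs]] ry; apply/hasP; exists s => //.
  by rewrite e; apply/hasP; exists r.
have sV : #|V| = \sum_(s <- cv) size s.
  rewrite -sum1_card (sum_parts predT (fun _ => 1)).
  by apply: eq_bigr => s _; rewrite sum1_size.
rewrite !sum_parts in hitR hitW.
(* The 4 comes from two residual edges at each of the two extremities. *)
have R_part s : s \in cv -> 4 * open s + closed s * out s <=
    \sum_(r <- s | isR r) \sum_(y | interior y) residual r y.
  move=> cs; have us := part_uniq cs; case: (boolP (open s)) => os.
    have ncl : closed s = false by apply: contraTF os; apply: closed_not_open.
    have [a [M [d ds]]] := open_shape cs os.
    have [ad aM] : a != d /\ a \notin M.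
      by move: us; rewrite ds /= mem_rcons inE negb_or => /andP[/andP[]].
    have [ra rd] : is_end s a /\ is_end s d.
      by rewrite /is_end ds /= last_rcons !(inE, mem_rcons) !eqxx !orbT.
    have es : ~~ even_cycle s by case/andP: os.
    have [iRa iRd] : isR a /\ isR d.
      by rewrite !(isRE s) ?es ?ra ?rd //; case/andP: ra; case/andP: rd.
    rewrite ncl addn0 {1}ds big_cons iRa -cats1 big_cat big_cons iRd big_nil /=.
    rewrite (residual_open_end cs os ra) (residual_open_end cs os rd); clear; lia.
  rewrite muln0 add0n; case: (boolP (closed s)) => // cl.
  rewrite mul1n /out [leqLHS]big_seq [leqRHS]big_seq_cond.
  rewrite [leqRHS](eq_bigl (fun r => r \in s)); last first.
    by move=> r; case: (boolP (r \in s)) => // rs;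
      rewrite (isRE s r cs rs) closed_not_even // closed_end.
  by apply: leq_sum => r rs; rewrite (residual_closed cs cl rs).
have W_part s : s \in cv -> weak s * out s <=
    \sum_(r <- s | isW r) \sum_(y | interior y) residual r y.
  move=> cs; case: (boolP (weak s)) => // ws.
  have cl : closed s by case/andP: ws.
  rewrite mul1n /out [leqLHS]big_seq [leqRHS]big_seq_cond.
  rewrite [leqRHS](eq_bigl (fun r => r \in s)); last first.
    by move=> r; case: (boolP (r \in s)) => // rs; rewrite (isWE s r cs rs).
  by apply: leq_sum => r rs; rewrite (residual_closed cs cl rs).
(* Of the [size s - 2] interior vertices of an open path, the unreached ones number at least the
   weakly reached ones minus one; hence at most [size s - 1] hits. *)
have gap_part s : s \in cv -> \sum_(y <- s | interior y) weakly_reached y +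
    \sum_(y <- s | interior y) reached y + 2 * open s <= open s * (size s).+1.
  move=> cs; have ic := interior_count cs.
  have sc (P : pred V) : \sum_(y <- s | interior y) P y = count (predI P interior) s.
    rewrite -sum1_count big_mkcond [RHS]big_mkcond; apply: eq_bigr => y _ /=.
    by case: (P y); case: (interior y).
  have : count (predI reached interior) s + count (predI (predC reached) interior) s = count
    interior s.
    by rewrite -!count_filter count_predC size_filter.
  rewrite !sc.
  have [os|os] := boolP (open s); last first.
    move: ic; rewrite (negPf os) /= addn0 mul0n => i0.
    have : count (predI weakly_reached interior) s <= count interior s.
      by apply: sub_count => y /andP[].
    by rewrite i0; clear; lia.
  move: ic; rewrite os.
  have : count (predI weakly_reached interior) s <= (count (predI (predC reached) interior) s).+1.
    apply: count_gap => A x B y D ds /andP[wx ix] /andP[wy iy].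
    have := gap cs os ds ix wx iy wy; congr (is_true _); apply: eq_has => z.
    by rewrite /= andbC.
  by clear; lia.
(* Balance of one component: for an open path, 5 plus at most [size s - 1] hits against
   [4 + size s]; a closed path receives no hits. *)
have part s : s \in cv -> 5 * ~~ even_cycle s +
    \sum_(y <- s | interior y) weakly_reached y +
    \sum_(y <- s | interior y) reached y <= weak s * out s + (4 * open s + closed s * out s) +
      size s.
  move=> cs; have := gap_part s cs; rewrite /open.
  have [cl|ncl] := boolP (closed s).
    rewrite (closed_not_even cl) /=; have := closed_weight cs cl; clear; lia.
  have [ev|nev] := boolP (even_cycle s); rewrite /= ?mul1n; clear; lia.
have : \sum_(s <- cv) (5 * ~~ even_cycle s +
    \sum_(y <- s | interior y) weakly_reached y +
    \sum_(y <- s | interior y) reached y) <=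
      \sum_(s <- cv) (weak s * out s + (4 * open s + closed s * out s) + size s).
  by rewrite big_seq [leqRHS]big_seq; apply: leq_sum.
have paths : \sum_(s <- cv) ~~ even_cycle s = count (predC even_cycle) cv.
  by rewrite -sum1_count [RHS]big_mkcond; apply: eq_bigr => s _ /=; case: even_cycle.
rewrite !big_split /= !big1_eq -sV paths.
move: hitR hitW.
have : \sum_(s <- cv) (4 * open s + closed s * out s) <=
    \sum_(s <- cv) \sum_(r <- s | isR r) \sum_(y | interior y) residual r y.
  by rewrite big_seq [leqRHS]big_seq; apply: leq_sum.
have : \sum_(s <- cv) weak s * out s <=
    \sum_(s <- cv) \sum_(r <- s | isW r) \sum_(y | interior y) residual r y.
  by rewrite big_seq [leqRHS]big_seq; apply: leq_sum.
rewrite !big_split /= !big1_eq; clear; lia.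
Qed.

End Minimal.

End Core.

(* In elimination form to stay constructive. *)
Lemma minimal_cover (V : finType) (m : V -> V -> nat) (P : bool) :
  (forall cv, cover m cv ->
    (forall cv', cover m cv' ->
      sumn (map (weight m) cv) <= sumn (map (weight m) cv')) -> P) -> P.
Proof.
move=> H; case: (boolP P) => // nP.
have no_cover n cv : cover m cv -> sumn (map (weight m) cv) < n -> False.
  elim: n cv => // n IH cv ccv; rewrite ltnS => le_n.
  apply/(negP nP)/(H cv ccv) => cv' ccv'; rewrite leqNgt; apply/negP => lt.
  exact: IH cv' ccv' (leq_trans lt le_n).
have /no_cover/(_ (ltnSn _)) [] : cover m [seq [:: x] | x <- enum V].
rewrite /cover; have -> : flatten [seq [:: x] | x <- enum V] = enum V.
  by elim: (enum V) => //= x s ->.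
by rewrite perm_refl; apply/allP => _ /mapP[x _ ->].
Qed.

(** * From covers to pairs of disjoint matchings *)

Section Matchings.

Variable G : multigraph.
Implicit Types (e f : edge G) (x y : vert G) (A B : {set edge G}).

(** Without [x != y] the diagonal would contain all edges at [x]. *)
Definition links x y := [set e : edge G | [&& x != y, incident x e & incident y e]].

Definition mult x y := #|links x y|.

Lemma multC x y : mult x y = mult y x.
Proof. by apply: eq_card => e; rewrite !inE eq_sym [incident x e && _]andbC. Qed.

Lemma multxx x : mult x x = 0.
Proof. by apply: eq_card0 => e; rewrite !inE eqxx. Qed.

(** After exchanging the sums, each edge at [x] is counted once, at its other endpoint. *)
Lemma mult_sum x : \sum_y mult x y = degree x.
Proof.
rewrite /degree -sum1_card; under eq_bigr do rewrite /mult -sum1_card big_mkcond.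
rewrite exchange_big [RHS]big_mkcond /=; apply: eq_bigr => e _; rewrite inE.
case: ifP => xe; last by rewrite big1 // => y _; rewrite inE xe andbF.
have other : exists2 z, x != z & incident x e && incident z e.
  have := loopless e; case/orP: xe => /eqP <- ne; [exists (dst e) | exists (src e)];
    by rewrite // 1?eq_sym // /incident !eqxx ?orbT.
case: other => z xz /andP[_ ze]; rewrite (bigD1 z) //= inE xz xe ze big1 // => y yz.
rewrite inE xe; case: eqP => //= xy; case: ifP => // ye; case/negP: yz.
move: xe ye ze xz xy; rewrite /incident.
by do 3![case/orP => /eqP <-]; rewrite ?eqxx.
Qed.

Lemma incident3 e x y z : incident x e -> incident y e -> incident z e ->
  [|| x == y, x == z | y == z].
Proof.
by rewrite /incident; do 3![case/orP => /eqP <-]; rewrite ?eqxx ?orbT.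
Qed.

Definition matching A := forall e f x,
  e \in A -> f \in A -> incident x e -> incident x f -> e = f.

Definition misses A x := forall e, e \in A -> ~~ incident x e.

Definition inside A (s : seq (vert G)) :=
  forall e x, e \in A -> incident x e -> x \in s.

Lemma matchingU1 A e x y : matching A -> e \in links x y -> misses A x -> misses A y ->
  matching (e |: A).
Proof.
move=> mA; rewrite inE => /and3P[xy xe ye] mx my.
have excl f z : f \in A -> incident z e -> incident z f -> False.
  move=> fA ze zf; have := incident3 xe ye ze; rewrite (negPf xy) /=.
  by case/orP=> /eqP h; [have := mx f fA|have := my f fA]; rewrite h zf.
move=> f1 f2 z /setU1P[->|f1A] /setU1P[->|f2A] z1 z2 //.
- by case: (excl f2 z).
- by case: (excl f1 z).
- exact: mA z1 z2.
Qed.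

Lemma matchingU A B s t : matching A -> matching B -> inside A s -> inside B t ->
  ~~ has (mem s) t -> matching (A :|: B).
Proof.
move=> mA mB iA iB /hasPn st.
have excl e f x : e \in A -> f \in B -> incident x e -> incident x f -> False.
  by move=> eA fB xe xf; have := st x (iB f x fB xf); rewrite /= (iA e x eA xe).
move=> e f x /setUP[] eA /setUP[] fA xe xf.
- exact: mA xe xf.
- by case: (excl e f x).
- by case: (excl f e x).
- exact: mB xe xf.
Qed.

Lemma path_matchings x t : uniq (x :: t) -> path (adj mult) x t -> exists A B,
  [/\ [/\ matching A, matching B & A :&: B = set0], inside (A :|: B) (x :: t),
      #|A| + #|B| = size t, misses B x /\ misses (if odd (size t) then B else A) (last x t)
    & forall e, e \in A -> incident x e -> incident (head x t) e].
Proof.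
elim: t x => [|y t IH] x.
  move=> _ _; exists set0, set0; split; rewrite ?cards0 //.
  - by split; rewrite ?set0I // => e f z; rewrite inE.
  - by move=> e z; rewrite setU0 inE.
  - by split=> e /=; rewrite inE.
rewrite cons_uniq => /andP[xt uyt] /andP[xy pyt].
have [A [B [[mA mB AB] iAB cAB [By lastAB] _]]] := IH y uyt pyt.
have xy' : x != y by apply: contraNneq xt => ->; rewrite inE eqxx.
move: xy; rewrite /adj card_gt0 => /set0Pn[e exy].
have /and3P[_ xe ye] : [&& x != y, incident x e & incident y e] by rewrite inE in exy.
have miss_x f : f \in A :|: B -> ~~ incident x f.
  by move=> fAB; apply: contra xt; apply: iAB.
have Bx : misses B x by move=> f fB; apply: miss_x; rewrite inE fB orbT.
have Ax : misses A x by move=> f fA; apply: miss_x; rewrite inE fA.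
have eAB : e \notin A :|: B by apply: contraL xe; apply: miss_x.
have [eA eB] : e \notin A /\ e \notin B by apply/andP; rewrite -negb_or -in_setU.
(* Prepending an edge swaps the roles: it joins [B], which misses [y]. *)
exists (e |: B), A; split.
- split=> //; first exact: matchingU1 exy Bx By.
  by rewrite setIUl setIC [B :&: A]setIC AB setU0; apply/setP => f; rewrite !inE;
    case: eqP => [->|]; rewrite ?(negPf eA) ?andbF.
- move=> f z; rewrite -setUA [B :|: A]setUC => /setU1P[-> ze|fAB zf].
    by have := incident3 xe ye ze; rewrite (negPf xy') !inE /= ![_ == z]eq_sym orbA => ->.
  by rewrite inE (iAB f z fAB zf) orbT.
- by rewrite cardsU1 eB /= -cAB addnAC addnC addnA; clear; lia.
- split=> //=; move: lastAB; case: (boolP (odd (size t))) => //= ot lastAB f.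
  case/setU1P => [->|]; last exact: lastAB.
  apply/negP => le; have := incident3 xe ye le; rewrite (negPf xy') /=.
  case: (lastP t) xt uyt ot {IH pyt iAB cAB lastAB le} => // t' l; rewrite last_rcons.
  rewrite !inE mem_rcons inE !negb_or => /and3P[_ /negPf-> _] /=.
  by rewrite mem_rcons inE negb_or => /andP[/andP[/negPf->]].
- move=> f /setU1P[-> //|fB] xf; by have := Bx f fB; rewrite xf.
Qed.

(** A path has one edge fewer than vertices; an even cycle gains its closing edge, put into [B],
    which misses both extremities. *)
Lemma part_matchings s : uniq s -> sorted (adj mult) s -> exists A B,
  [/\ matching A, matching B, A :&: B = set0, inside (A :|: B) s
    & size s <= #|A| + #|B| + ~~ even_cycle mult s].
Proof.
case: s => [|x t] us ps.
  by exists set0, set0; split; rewrite ?set0I ?setU0 //; move=> e z; rewrite inE.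
have [A [B [[mA mB AB] iAB cAB [Bx lastAB] Axy]]] := path_matchings us ps.
case: (boolP (even_cycle mult (x :: t))) => [/andP[]|nev]; last first.
  by exists A, B; split; rewrite //= cAB; clear; lia.
rewrite /= negbK => ot lt_m; rewrite ot in lastAB.
(* On two vertices, the matching [A] cannot contain two parallel edges; on more, an edge of [A] at
   [x] leads to the second vertex, not to the last. *)
have [e eL eA] : exists2 e, e \in links x (last x t) & e \notin A.
  suff /subsetPn[e eL eA] : ~~ (links x (last x t) \subset A) by exists e.
  apply/negP => /subsetP LA; move: us lt_m Axy LA; rewrite /mult.
  case: t {ps ot iAB cAB lastAB} => [|y [|z t]] /= us.
  - by move=> lt_m; case/card_gt0P: (leq_ltn_trans (leq0n _) lt_m) => e; rewrite inE eqxx.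
  - case/card_gt1P => e [f [eL fL ne]] _ LA; case/eqP: ne.
    move: (LA e eL) (LA f fL); move: eL fL; rewrite !inE.
    by case/and3P=> _ xe _ /and3P[_ xf _] eA fA; apply: mA xe xf.
  - case/card_gt0P => e eL Axy LA; have eA := LA e eL.
    move: eL; rewrite inE => /and3P[xl xe le].
    have := incident3 xe (Axy e eA xe) le; rewrite (negPf xl) /=.
    case/andP: us => xt /andP[yt _]; case/orP => /eqP eq.
      by move: xt; rewrite eq inE eqxx.
    by move: yt; rewrite eq mem_last.
have /and3P[xl xe le] : [&& x != last x t, incident x e & incident (last x t) e].
  by rewrite inE in eL.
have eB : e \notin B by apply: contraL xe; apply: Bx.
exists A, (e |: B); split=> //.
- exact: matchingU1 eL Bx lastAB.
- apply/setP => f; rewrite !inE; case: eqP => [->|_]; first by rewrite (negPf eA).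
  by have := congr1 (fun S : {set edge G} => f \in S) AB; rewrite !inE.
- move=> f z; rewrite setUCA => /setU1P[-> ze|fAB zf]; last exact: iAB zf.
  have := incident3 xe le ze; rewrite (negPf xl) /= => /orP[]/eqP <-.
    by rewrite inE eqxx.
  exact: mem_last.
- by rewrite cardsU1 eB /= addnCA cAB; clear; lia.
Qed.

Lemma cover_matchings (cv : seq (seq (vert G))) :
  uniq (flatten cv) -> all (sorted (adj mult)) cv -> exists A B,
  [/\ matching A, matching B, A :&: B = set0, inside (A :|: B) (flatten cv)
    & size (flatten cv) <= #|A| + #|B| + count (predC (even_cycle mult)) cv].
Proof.
elim: cv => [|s cv IH] /=.
  by move=> _ _; exists set0, set0; split; rewrite ?set0I ?setU0 //; move=> e z; rewrite inE.
rewrite cat_uniq => /and3P[us dis ucv] /andP[ps pcv].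
have [A1 [B1 [mA1 mB1 AB1 i1 c1]]] := part_matchings us ps.
have [A2 [B2 [mA2 mB2 AB2 i2 c2]]] := IH ucv pcv.
have sub A B s' : inside (A :|: B) s' -> inside A s' /\ inside B s'.
  by move=> i; split=> e z ez; apply: i; rewrite inE ez ?orbT.
have [iA1 iB1] := sub _ _ _ i1; have [iA2 iB2] := sub _ _ _ i2.
have empty A B : inside A s -> inside B (flatten cv) -> A :&: B = set0.
  move=> iA iB; apply/setP => e; rewrite !inE; apply/negP => /andP[eA eB].
  have se : incident (src e) e by rewrite /incident eqxx.
  by case/hasP: dis; exists (src e); [apply: iB se|apply: iA se].
exists (A1 :|: A2), (B1 :|: B2); split.
- exact: matchingU dis.
- exact: matchingU dis.
- by rewrite setIUl !setIUr AB1 AB2 (empty A1 B2) // [A2 :&: B1]setIC (empty B1 A2) // !setU0.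
- move=> e z; rewrite setUACA mem_cat => /setUP[] ei ze.
    by rewrite (i1 e z ei ze).
  by rewrite (i2 e z ei ze) orbT.
- rewrite !cardsU (empty A1 A2) // (empty B1 B2) // cards0 !subn0 size_cat.
  by apply: leq_trans (leq_add c1 c2) _; rewrite addnACA [X in X + _ <= _]addnACA.
Qed.

Lemma matchings_nu A B : matching A -> matching B -> A :&: B = set0 -> #|A| + #|B| <= nu G 2.
Proof.
move=> mA mB AB; have -> : #|A| + #|B| = #|A :|: B| by rewrite cardsU AB cards0 subn0.
apply: leq_bigmax_cond; apply/existsP.
exists [ffun e => if e \in A then ord0 else ord_max].
apply/forall_inP => e eAB; apply/forall_inP => f fAB; apply/implyP.
case/andP=> ne /existsP[x /andP[xe xf]]; apply: contra ne; rewrite !ffunE.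
move: eAB fAB; rewrite !inE; case: ifP => eA; case: ifP => fA //= eB fB _; apply/eqP.
- exact: mA xe xf.
- exact: mB xe xf.
Qed.

End Matchings.

Theorem theorem2 (G : multigraph) :
  cubic G -> 4 * #|vert G| <= 5 * nu G 2.
Proof.
move=> cubG; apply: (@minimal_cover (vert G) (@mult G)) => cv ccv cvmin.
have m3 (x : vert G) : \sum_y mult x y = 3 by rewrite mult_sum cubG.
have := few_paths (@multC G) (@multxx G) m3 ccv cvmin.
case/andP: (ccv) => pcv scv.
have ucv : uniq (flatten cv) by rewrite (perm_uniq pcv) enum_uniq.
have [A [B [mA mB AB _]]] := cover_matchings ucv scv.
rewrite (perm_size pcv) -cardE => le_V le_p; have le_nu := matchings_nu mA mB AB.
(* Here [p] counts the components that are not even cycles and [a] the edges of the two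
   matchings. *)
have arith p a n N : n <= a + p -> 5 * p <= n -> a <= N -> 4 * n <= 5 * N by clear; lia.
exact: arith le_V le_p le_nu.
Qed.
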